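(* Let $p,q\in\mathbb N$ be coprime with $p<q$. Then the number of $(p,q)$-tilted Sperner families in $\mathcal P(n)$ is $$2^{(q-p+o(1))\binom{n}{\lfloor n/2\rfloor}},$$ where $o(1)\to 0$ as $n\to\infty$.
   Context: $\mathcal P(n)$ denotes the family of all subsets of $[n]=\{1,\dots,n\}$. For $p,q\in\mathbb N$, a family $\mathcal A\subseteq\mathcal P(n)$ is a $(p,q)$-tilted Sperner family if $\mathcal A$ does not contain two distinct sets $A,B$ with $q|A\setminus B|=p|B\setminus A|$. (The paper omits floors and ceilings; $\binom{n}{n/2}$ is read as $\binom{n}{\lfloor n/2\rfloor}$.) *)

(* Defs.v *)
From HB Require Import structures.
From mathcomp Require Import all_boot.

Set Implicit Arguments.
Unset Strict Implicit.
Unset Printing Implicit Defensive.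

(* The pair (A, B) is ordered; p = 0, q = 1 gives the usual Sperner families.  *)
Definition tilted_sperner (p q n : nat) (F : {set {set 'I_n}}) : bool :=
  ~~ [exists A in F, exists B in F,
        (A != B) && (q * #|A :\: B| == p * #|B :\: A|)].

Definition tilted_sperner_families (p q n : nat) : {set {set {set 'I_n}}} :=
  [set F : {set {set 'I_n}} | tilted_sperner p q F].

(* Main.v *)
(* Upper bound.  If every member of a family F has fewer than d relatives in F,
   where d is a small multiple of n, then |F| <= (q - p + o(1)) C(n, n/2): up
   to a random permutation of the ground set, fix for each residue class of
   sizes modulo q - p the chain whose consecutive members lose p elements and
   gain q.  Any two members of such a chain are related, so the expected number
   of members of F that are hit exceeds q - p by at most the expected number of
   related pairs of hits; and a given related pair is hit with conditional
   probability O(1/n).  Sizes far from n/2 are negligible by Chebyshev.  Hence,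
   as long as a family is larger than this, it has a vertex v of out-degree at
   least d, and the number of independent subfamilies of S satisfies
   I(S) <= I(S - v) + I(S - v - N(v)).  This recursion costs a factor
   x ^ (2 ^ n) with x = 1 + o(1 / sqrt n), that is 2 ^ (o(1) C(n, n/2)).

   Lower bound.  A union of q - p consecutive layers contains no related pair,
   so all families of sets from the q - p layers above n/2 are counted. *)
Require Import Defs.
From HB Require Import structures.
From mathcomp Require Import all_boot all_order all_algebra.
From mathcomp Require Import fingroup perm.
From mathcomp Require Import all_classical all_reals all_analysis.
From mathcomp Require Import zify ring lra.
Import Order.TTheory GRing.Theory Num.Theory.
Import numFieldNormedType.Exports.

(** * Counting independent sets by the Kleitman-Winston recursion *)

Definition independent {T : finType} (e : rel T) (F : {set T}) : bool :=
  ~~ [exists u in F, exists v in F, e u v].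

Lemma independentP {T : finType} (e : rel T) (F : {set T}) :
  reflect {in F &, forall u v, ~~ e u v} (independent e F).
Proof.
apply: (iffP idP) => [H u v uF vF|H].
  apply: contra H => euv; apply/existsP; exists u; rewrite uF /=.
  by apply/existsP; exists v; rewrite vF.
apply/negP => /existsP[u /andP[uF /existsP[v /andP[vF]]]].
by apply/negP; apply: H.
Qed.

Section Containers.
Local Open Scope ring_scope.

(* Kleitman-Winston: a vertex v of large out-degree either is not chosen, or
   rules out all its out-neighbours. *)
Lemma card_independent_le {R : realType} {T : finType} (e : rel T)
    (d M : nat) (x : R) :
  irreflexive e -> 1 <= x -> x ^+ d + 1 <= x ^+ d.+1 ->
  (forall S : {set T},
     {in S, forall v, #|[set u in S | e v u]| < d}%N -> (#|S| <= M)%N) ->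
  forall S : {set T},
    #|[set F : {set T} | (F \subset S) && independent e F]|%:R
      <= 2 ^+ M * x ^+ #|S|.
Proof.
move=> e_irr x_ge1 x_rec small S.
have [m] := ubnP #|S|; elim: m S => // m IH S; rewrite ltnS => Sm.
have xn_ge1 k : 1 <= x ^+ k by exact: exprn_ege1.
(* If no vertex has [d] out-neighbours in [S], then [S] has at most [M] elements and all its subsets
   may be counted. *)
have [/forall_inP H|] := boolP [forall v in S, (#|[set u in S | e v u]| < d)%N].
  have SM := small S H.
  apply: (@le_trans _ _ (2 ^+ #|S|)).
    rewrite -natrX ler_nat -card_powerset; apply: subset_leq_card.
    by apply/fintype.subsetP => F; rewrite !inE => /andP[].
  apply: (@le_trans _ _ (2 ^+ M)); last by rewrite ler_peMr ?exprn_ge0.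
  by rewrite ler_weXn2l// ler1n.
rewrite negb_forall => /existsP[v]; rewrite negb_imply -leqNgt => /andP[vS dv].
set W := [set u in S | e v u] in dv.
set I := fun A : {set T} =>
  [set F : {set T} | (F \subset A) && independent e F].
(* Independent sets avoiding [v] lie in [S :\ v]; those containing [v] miss [W], and deleting [v]
   from them is injective. *)
have split_le : (#|I S| <= #|I (S :\ v)| + #|I ((S :\ v) :\: W)|)%N.
  rewrite -(cardsID [set F : {set T} | v \in F] (I S)) addnC leq_add//.
    apply: subset_leq_card; apply/fintype.subsetP => F; rewrite !inE.
    by move=> /andP[vF /andP[FS ->]]; rewrite subsetD1 FS vF.
  rewrite -(@card_in_imset _ _ (fun F : {set T} => F :\ v)); last first.
    move=> F G; rewrite !inE => /andP[_ vF] /andP[_ vG] FG.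
    by rewrite -(finset.setD1K vF) FG finset.setD1K.
  apply: subset_leq_card; apply/fintype.subsetP => _ /imsetP[F + ->].
  rewrite !inE => /andP[/andP[FS /independentP Find] vF].
  apply/andP; split; last first.
    apply/independentP => a b; rewrite !inE => /andP[_ aF] /andP[_ bF].
    exact: Find.
  apply/fintype.subsetP => u; rewrite !inE => /andP[uv uF].
  by rewrite uv (fintype.subsetP FS) //= andbT (negbTE (Find _ _ vF uF)).
have S1 : #|S| = #|S :\ v|.+1 by rewrite (cardsD1 v) vS.
have WS : W \subset S :\ v.
  apply/fintype.subsetP => u; rewrite !inE => /andP[-> evu]; rewrite andbT.
  by apply/eqP => uv; rewrite uv e_irr in evu.
have S2 : (#|(S :\ v) :\: W| + d <= #|S :\ v|)%N.
  have := cardsD (S :\ v) W; rewrite (finset.setIidPr WS).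
  by have := subset_leq_card WS; lia.
apply: (@le_trans _ _ (#|I (S :\ v)|%:R + #|I ((S :\ v) :\: W)|%:R)).
  by rewrite -natrD ler_nat.
apply: (@le_trans _ _ (2 ^+ M * x ^+ #|S :\ v| + 2 ^+ M * x ^+ (#|S :\ v| - d))).
  apply: lerD; first by apply: IH; lia.
  apply: (@le_trans _ _ (2 ^+ M * x ^+ #|(S :\ v) :\: W|)); first by apply: IH; lia.
  by rewrite ler_wpM2l ?exprn_ge0// ler_weXn2l//; lia.
rewrite -mulrDr ler_wpM2l ?exprn_ge0// S1.
(* Factoring out [x ^+ s] leaves exactly the recursion inequality assumed for [x]. *)
have [s ->] : exists s, #|S :\ v| = (s + d)%N by exists (#|S :\ v| - d)%N; lia.
rewrite addnK -addnS !exprD -{2}[x ^+ s]mulr1 -mulrDr ler_wpM2l//.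
by apply: le_trans (xn_ge1 s).
Qed.
End Containers.

(** * Images of sets under random permutations *)

Section PermutedSets.
Context {T : finType}.
Implicit Types (s t : {perm T}) (A B : {set T}).

Lemma imset_permM s t A : (s * t)%g @: A = t @: (s @: A).
Proof. by rewrite -imset_comp; apply: eq_imset => z; rewrite permM. Qed.

(** Induction on [#|A :\: B|]: swapping a point of [A :\: B] with one of [B :\: A] decreases it. *)
Lemma exists_perm_imset A B : #|A| = #|B| -> exists s, s @: B = A.
Proof.
have [m] := ubnP #|A :\: B|; elim: m B => // m IH B; rewrite ltnS => ABm AB.
have [BA|] := boolP (A \subset B).
  by exists 1%g; rewrite imset_perm1; apply/eqP; rewrite eq_sym eqEcard BA AB leqnn.
case/subsetPn => x xA xB.
have : ~~ (B \subset A).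
  by apply/negP => BA; move: xB; have /eqP -> : B == A; rewrite ?xA// eqEcard BA AB leqnn.
case/subsetPn => y yB yA.
have [||s <-] := IH (tperm x y @: B).
- apply: leq_trans ABm; rewrite (cardsD1 x (A :\: B)) !inE xA xB ltnS.
  apply: subset_leq_card; apply/fintype.subsetP => z; rewrite !inE => /andP[zB' zA].
  have zx : z != x.
    by apply: contraNneq zB' => ->; apply/imsetP; exists y; rewrite ?tpermR.
  have zy : z != y by apply: contraTneq zA => ->.
  rewrite zx zA andbT /=; apply: contra zB' => zB; apply/imsetP; exists z => //.
  by rewrite tpermD // eq_sym.
- by rewrite card_imset //; exact: perm_inj.
- by exists (tperm x y * s)%g; rewrite imset_permM.
Qed.

Lemma card_all_perm : #|{perm T}| = (#|T|)`!.
Proof.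
rewrite -[in RHS]cardsT -card_perm; apply: eq_card => s.
by rewrite !inE; symmetry; apply/fintype.subsetP => z; rewrite inE.
Qed.

(** Translation by a fixed permutation matches the fibres of [s |-> s @: B], so a random image of
    [B] is uniform among the sets of its size. *)
Lemma card_perm_imset A B : #|A| = #|B| ->
  (#|[set s : {perm T} | s @: B == A]| * 'C(#|T|, #|B|) = (#|T|)`!)%N.
Proof.
move=> AB; rewrite -(card_draws T #|B|).
rewrite -card_all_perm -[RHS]sum1_card.
rewrite (partition_big (fun s : {perm T} => s @: B)
  (mem [set C : {set T} | #|C| == #|B|])) /=; last first.
  by move=> s _; rewrite inE card_imset //; exact: perm_inj.
rewrite mulnC -sum_nat_const; apply: eq_bigr => C; rewrite inE => /eqP CB.
rewrite sum1dep_card.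
have [t <-] := @exists_perm_imset C A (etrans CB (esym AB)).
rewrite -(@card_imset _ _ (mulg^~ t)); last exact: mulIg.
apply: eq_card => s; rewrite !inE; apply/imsetP/eqP => [[u]|sB].
  by rewrite inE => /eqP uB ->; rewrite imset_permM uB.
exists (s * t^-1)%g; last by rewrite mulgKV.
by rewrite inE imset_permM sB -imset_permM mulgV imset_perm1.
Qed.

(* Multiplying by the transpositions (x y), y outside A and A', moves A' into
   distinct sets and fixes A. *)
Lemma card_perm_imset2_le A A' B B' : ~~ (A' \subset A) ->
  (#|[set s : {perm T} | (s @: B == A) && (s @: B' == A')]| * #|~: (A :|: A')|
     <= #|[set s : {perm T} | s @: B == A]|)%N.
Proof.
case/subsetPn => x xA' xA; rewrite -cardsX.
rewrite -(@card_in_imset _ _ (fun u : {perm T} * T => (u.1 * tperm x u.2)%g)).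
  apply: subset_leq_card; apply/fintype.subsetP => _ /imsetP[[s y] /= + ->].
  rewrite !inE /= negb_or => /andP[/andP[/eqP sB _] /andP[yA _]].
  rewrite imset_permM sB -[eqbRHS]imset_id; apply/eqP/eq_in_imset => z zA.
  by rewrite tpermD //; [apply: contraNneq xA | apply: contraNneq yA] => ->.
move=> [s y] [s' y'] /=; rewrite !inE /= !negb_or.
move=> /andP[/andP[_ /eqP sA'] /andP[_ yA']] /andP[/andP[_ /eqP sA'2] /andP[_ yA'2]] E.
(* The image of [B'] under the product is [A'] with [x] replaced by [y], so [y] is its only point
   outside [A'] and can be recovered. *)
suff yy' : y = y' by move: E; rewrite yy' => /mulIg ->.
apply/eqP; apply: contraNT yA' => yy'.
have : y \in (s' * tperm x y')%g @: B'.
  by rewrite -E imset_permM sA'; apply/imsetP; exists x; rewrite ?tpermL.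
rewrite imset_permM sA'2 => /imsetP[z zA']; case: tpermP => [_ yE|zE|_ _ -> //].
  by rewrite yE eqxx in yy'.
by rewrite -zE zA' in yA'2.
Qed.
End PermutedSets.

(** * The tilted relation and chains of related sets *)

Definition tilted_rel (p q n : nat) : rel {set 'I_n} := fun A B =>
  (A != B) && (q * #|A :\: B| == p * #|B :\: A|).

Lemma tilted_sperner_independent p q n (F : {set {set 'I_n}}) :
  tilted_sperner p q F = independent (tilted_rel p q n) F.
Proof. by []. Qed.

(** If [#|B :\: A| <= #|A :\: B|], the equation with [p < q] makes both differences empty, against
    [A != B]. *)
Lemma tilted_rel_card_lt {p q n : nat} {A B : {set 'I_n}} :
  p < q -> tilted_rel p q n A B -> #|A| < #|B|.
Proof.
move=> pq /andP[AB /eqP E].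
have := cardsID B A; have := cardsID A B; rewrite finset.setIC => a b.
rewrite -a -b ltn_add2l ltnNge; apply/negP => le.
have B0 : #|B :\: A| = 0.
  apply/eqP; rewrite -leqn0 leqNgt; apply/negP => pos.
  have : p * #|B :\: A| < q * #|B :\: A| by rewrite ltn_pmul2r.
  by rewrite -E; apply/negP; rewrite -leqNgt leq_mul2l le orbT.
have A0 : #|A :\: B| = 0.
  by apply/eqP; move/eqP: E; rewrite B0 muln0 muln_eq0; case: q pq.
case/eqP: AB; apply/eqP; rewrite finset.eqEsubset -!finset.setD_eq0.
by rewrite -!cards_eq0 A0 B0.
Qed.

Lemma tilted_rel_imset {p q n : nat} (s : {perm 'I_n}) (A B : {set 'I_n}) :
  tilted_rel p q n (s @: A) (s @: B) = tilted_rel p q n A B.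
Proof.
have sI : injective s by exact: perm_inj.
rewrite /tilted_rel -!preim_permV -!preimsetD !preim_permV.
by rewrite !(card_imset _ sI) (inj_eq (imset_inj sI)).
Qed.

Lemma card_ord_interval (n a b : nat) : b <= n ->
  #|[set x : 'I_n | a <= x < b]| = b - a.
Proof.
move=> bn; rewrite -sum1dep_card.
rewrite -(big_mkord (fun x => a <= x < b) (fun=> 1)).
rewrite -(big_nat_widen 0 b n (fun x => a <= x)) //.
rewrite -(big_nat_widenl a 0 b xpredT (fun=> 1)) //.
by rewrite sum_nat_const_nat muln1.
Qed.

Section Chains.
Context (p q n L : nat).

(* Consecutive members of a residue class of sizes modulo q - p differ by
   removing p elements on the left and adding q elements on the right. *)
Definition tilted_chain (k : nat) : {set 'I_n} :=
  [set x : 'I_n | p * ((k - L) %/ (q - p)) <= x < k + p * ((k - L) %/ (q - p))].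

Lemma tilted_chain_shift_le U k : k < U ->
  p * ((k - L) %/ (q - p)) <= p * (U - L).
Proof.
move=> kU; rewrite leq_mul2l (leq_trans (leq_div _ _)) ?orbT //.
by rewrite leq_sub2r // ltnW.
Qed.

Context (U : nat) (lt_pq : p < q) (pUL : p * (U - L) <= L)
  (Un : U + p * (U - L) <= n).

Lemma card_tilted_chain k : k < U -> #|tilted_chain k| = k.
Proof.
move=> kU; have := tilted_chain_shift_le U k kU => H.
by rewrite card_ord_interval; lia.
Qed.

(** Equal residues give [k - j = (q - p) * (b - a)] for the quotients [a], [b]. The left ends then
    differ by [p * (b - a)] and the right ends by [q * (b - a)]. *)
Lemma tilted_chain_rel j k : L <= j < k -> k < U ->
  j - L = k - L %[mod q - p] -> tilted_rel p q n (tilted_chain j) (tilted_chain k).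
Proof.
move=> /andP[Lj jk] kU jkmod; have jU : j < U by lia.
have pa := tilted_chain_shift_le U j jU; have pb := tilted_chain_shift_le U k kU.
have ja := divn_eq (j - L) (q - p); have kb := divn_eq (k - L) (q - p).
rewrite jkmod in ja; apply/andP; split.
  by apply/eqP => E; have := card_tilted_chain j jU; rewrite E card_tilted_chain //; lia.
rewrite /tilted_chain.
move: pa pb ja kb.
set a := (j - L) %/ (q - p); set b := (k - L) %/ (q - p) => pa pb ja kb.
have ab : a <= b by rewrite /a /b leq_div2r //; lia.
have pab : p * a <= p * b by rewrite leq_mul2l ab orbT.
(* Since [p * b <= L <= j], the two intervals overlap, and each difference is again an interval. *)
have -> : [set x : 'I_n | p * a <= x < j + p * a] :\: [set x : 'I_n | p * b <= x < k + p * b] =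
    [set x : 'I_n | p * a <= x < p * b].
  by apply/setP => x; rewrite !inE; lia.
have -> : [set x : 'I_n | p * b <= x < k + p * b] :\: [set x : 'I_n | p * a <= x < j + p * a] =
    [set x : 'I_n | j + p * a <= x < k + p * b].
  by apply/setP => x; rewrite !inE; lia.
rewrite !card_ord_interval; [|lia..].
have -> : k + p * b - (j + p * a) = q * (b - a).
  clear pa pb pab pUL Un; move: ja kb ab lt_pq Lj jk.
  move: a b ((k - L) %% _) => a b r.
  move=> ja kb /subnKC; move: (b - a) => e be; rewrite -{}be in kb *.
  move=> /ltnW/subnKC; move: ja kb; move: (q - p) => g ja kb <- Lj jk.
  by lia.
by rewrite -mulnBr mulnCA.
Qed.
End Chains.

Lemma bin_le_central n k : 'C(n, k) <= 'C(n, n./2).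
Proof.
have incr m : m.*2 < n -> 'C(n, m) <= 'C(n, m.+1).
  by move=> mn; rewrite -(leq_pmul2l (ltn0Sn m)) mul_bin_left leq_mul2r; lia.
have below m : m <= n./2 -> 'C(n, m) <= 'C(n, n./2).
  move=> /subKn <-; elim: (n./2 - m) => [|i IH]; first by rewrite subn0.
  apply: leq_trans IH; have [hi|hi] := leqP n./2 i.
    by have -> : n./2 - i.+1 = n./2 - i by lia.
  have -> : n./2 - i = (n./2 - i.+1).+1 by lia.
  by apply: incr; lia.
have [kn|nk] := leqP k n; last by rewrite bin_small.
have [kh|kh] := leqP k n./2; first exact: below.
by rewrite -bin_sub //; apply: below; lia.
Qed.

(** * Supersaturation for families in a window of sizes *)

Section Supersaturation.
Context (p q n L U : nat).
Context (lt_pq : p < q) (pUL : p * (U - L) <= L) (Un : U + p * (U - L) <= n).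
Implicit Types (F : {set {set 'I_n}}) (A : {set 'I_n}) (s : {perm 'I_n}).
Local Notation rel := (tilted_rel p q n).
Local Notation chain := (tilted_chain p q n L).

(** Chain members are indexed by their size, so [A] can lie on the permuted chain only as the image
    of [chain #|A|]. *)
Let hit s A := s @: chain #|A| == A.

(* Hits without a predecessor have sizes in distinct residue classes. *)
Lemma card_hits_le F s : {in F, forall A, L <= #|A| < U} ->
  #|[set A in F | hit s A]| <=
    (q - p) + #|[set AA : {set 'I_n} * {set 'I_n} |
      [&& AA.1 \in F, AA.2 \in F & rel AA.1 AA.2] && (hit s AA.1 && hit s AA.2)]|.
Proof.
move=> FLU; set X := [set A in F | hit s A]; set P := [set AA | _].
(* A hit preceded by another hit is charged to that pair; the remaining hits inject into the
   residues modulo [q - p]. *)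
rewrite -(cardsID [set A | [exists B in X, rel B A]] X) addnC leq_add //.
  set X0 := X :\: _.
  have inj : {in X0 &, injective (fun A => inord ((#|A| - L) %% (q - p)) : 'I_(q - p).-1.+1)}.
    have ltmod m : m %% (q - p) < (q - p).-1.+1 by rewrite prednK ?ltn_mod subn_gt0.
    have no_rel A B : A \in X0 -> B \in X0 ->
        #|A| - L = #|B| - L %[mod q - p] -> #|B| <= #|A|.
      rewrite !inE => /andP[_ /andP[AF /eqP sA]] /andP[+ /andP[BF /eqP sB]] AB.
      rewrite leqNgt; apply: contraNN => ltAB; apply/existsP; exists A.
      rewrite inE AF /hit sA eqxx /=.
      have /andP[LA _] := FLU A AF; have /andP[_ BU] := FLU B BF.
      rewrite -sA -sB tilted_rel_imset; apply: (tilted_chain_rel _ _ _ _ U) => //.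
      by rewrite LA.
    move=> A B A0 B0 /(congr1 val); rewrite /= !inordK // => AB.
    (* Hits of equal size are images of the same chain member, hence equal. *)
    have cAB : #|A| = #|B|.
      by apply/eqP; rewrite eqn_leq (no_rel B A) // (no_rel A B).
    move: A0 B0; rewrite !inE => /andP[_ /andP[_ /eqP <-]] /andP[_ /andP[_ /eqP <-]].
    by rewrite cAB.
  rewrite -(card_in_imset inj) -[leqRHS]prednK ?subn_gt0 //.
  by rewrite -[leqRHS]card_ord max_card.
apply: leq_trans (leq_imset_card snd P); apply: subset_leq_card.
apply/fintype.subsetP => A; rewrite !inE => /andP[/andP[AF hA] /existsP[B]].
rewrite inE => /andP[/andP[BF hB] BA]; apply/imsetP; exists (B, A) => //.
by rewrite inE /= BF AF BA hB.
Qed.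

(** A random permutation hits [A] with probability [1 / 'C(n, #|A|)], at least the inverse of the
    central coefficient. *)
Lemma sum_hits F : {in F, forall A, #|A| < U} ->
  #|F| * n`! <= 'C(n, n./2) * \sum_(A in F) #|[set s | hit s A]|.
Proof.
move=> FU; rewrite big_distrr -sum_nat_const; apply: leq_sum => A AF.
have AU := FU A AF.
have := @card_perm_imset _ A (chain #|A|) (esym (card_tilted_chain _ _ _ _ _ lt_pq pUL Un _ AU)).
by rewrite card_ord => <-; rewrite mulnC leq_mul2r (bin_le_central n _) orbT.
Qed.

(** At least [c] points lie outside any two chain members of the window, so a related pair is hit at
    most [1 / c] times as often as its first set. With fewer than [d] relatives per set, hit pairs
    number at most [d / c] times the hits, while hits exceed hit pairs by at most [q - p] per
    permutation. *)
Lemma sparse_tilted_card_le F c d :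
    {in F, forall A, L <= #|A| < U} -> U + p * (U - L) + c <= n ->
    {in F, forall A, #|[set B in F | rel A B]| < d} ->
  (c - d) * #|F| <= c * (q - p) * 'C(n, n./2).
Proof.
move=> FLU Unc Fd.
set S := \sum_(A in F) #|[set s | hit s A]|.
pose K := [set AA : {set 'I_n} * {set 'I_n} |
  [&& AA.1 \in F, AA.2 \in F & rel AA.1 AA.2]].
pose N2 AA := #|[set s | hit s AA.1 && hit s AA.2]|.
have count : S <= (q - p) * n`! + \sum_(AA in K) N2 AA.
  have -> : S = \sum_s #|[set A in F | hit s A]|.
    under [RHS]eq_bigr do rewrite -sum1dep_card.
    rewrite /S; under eq_bigr do rewrite -sum1dep_card.
    by rewrite (exchange_big_dep predT).
  have -> : \sum_(AA in K) N2 AA =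
      \sum_s #|[set AA in K | hit s AA.1 && hit s AA.2]|.
    under eq_bigr do rewrite /N2 -sum1dep_card.
    under [RHS]eq_bigr do rewrite -sum1dep_card.
    by rewrite (exchange_big_dep predT).
  have <- : #|{perm 'I_n}| = n`! by rewrite card_all_perm card_ord.
  rewrite mulnC -sum_nat_const -big_split; apply: leq_sum => s _.
  apply: leq_trans (card_hits_le F s FLU) _; rewrite leq_add2l.
  by apply: subset_leq_card; apply/fintype.subsetP => AA; rewrite !inE.
have pair_le AA : AA \in K -> N2 AA * c <= #|[set s | hit s AA.1]|.
  case: AA => A B; rewrite inE /= => /and3P[AF BF AB].
  have lt := tilted_rel_card_lt lt_pq AB.
  (* If some [s] hits both sets, their union is the image of a union of two chain members, which
     lies in an initial interval of length [U + p * (U - L)]. *)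
  have [->|] := posnP (N2 (A, B)); first by rewrite mul0n.
  rewrite card_gt0 => /set0Pn[s]; rewrite inE /= => /andP[/eqP hA /eqP hB].
  have BA : ~~ (B \subset A).
    by apply/negP => /subset_leq_card; rewrite leqNgt lt.
  apply: leq_trans (@card_perm_imset2_le _ A B (chain #|A|) (chain #|B|) BA).
  rewrite leq_mul2l; apply/orP; right.
  rewrite -{1}hA -{1}hB -imsetU.
  have AU : #|A| < U by case/andP: (FLU A AF).
  have BU : #|B| < U by case/andP: (FLU B BF).
  have := cardsC (s @: (chain #|A| :|: chain #|B|)).
  rewrite card_ord (card_imset _ (@perm_inj _ s)) => cardC.
  have : #|(chain #|A| :|: chain #|B|)| <= U + p * (U - L).
    rewrite -[leqRHS]subn0 -(@card_ord_interval n) //.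
    apply: subset_leq_card; apply/fintype.subsetP => x; rewrite !inE.
    have := tilted_chain_shift_le p q L U _ AU.
    have := tilted_chain_shift_le p q L U _ BU.
    lia.
  lia.
have deg : c * \sum_(AA in K) N2 AA <= d * S.
  rewrite big_distrr /=.
  apply: (@leq_trans (\sum_(AA in K) #|[set s | hit s AA.1]|)).
    by apply: leq_sum => AA /pair_le; rewrite mulnC.
  rewrite /S big_distrr /= (eq_bigl (fun AA => (AA.1 \in F) && ((AA.2 \in F) && rel AA.1 AA.2))).
  rewrite -(pair_big_dep (mem F) (fun A B => (B \in F) && rel A B) (fun A _ => #|[set s | hit s A]|)) /=.
    apply: leq_sum => A AF; rewrite sum_nat_const leq_mul2r ltnW ?orbT //.
    by rewrite -cardsE; exact: Fd.
  by move=> AA; rewrite inE.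
have main : (c - d) * S <= c * (q - p) * n`!.
  rewrite mulnBl leq_subLR -mulnA.
  apply: (@leq_trans (c * ((q - p) * n`! + \sum_(AA in K) N2 AA))).
    by rewrite leq_mul2l count orbT.
  by rewrite mulnDr addnC leq_add2r.
have := sum_hits F (fun A AF => proj2 (andP (FLU A AF))).
rewrite -/S => FS.
rewrite -(leq_pmul2r (fact_gt0 n)) -mulnA.
apply: leq_trans (leq_mul (leqnn (c - d)) FS) _.
by rewrite mulnCA [leqRHS]mulnAC [leqRHS]mulnC leq_mul2l main orbT.
Qed.
End Supersaturation.

(** * Binomial estimates: central coefficient, nearby layers, tails *)

Lemma central_bin_lower n : 4 ^ n <= (n.*2 + 3) * 'C(n, n./2) ^ 2.
Proof.
have mid m : 'C(m.*2.+1, m.+1) = 'C(m.*2.+1, m).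
  by rewrite -[LHS]bin_sub; [congr 'C(_, _); lia|lia].
have step m : m.+1 * 'C(m.*2.+2, m.+1) = 2 * m.*2.+1 * 'C(m.*2, m).
  by rewrite binS -mid addnn -mul2n mulnCA -mul_bin_diag mulnA.
(* The even case goes by induction. The odd case [n = 2m + 1] follows from
   ['C(2m + 2, m + 1) = 2 'C(2m + 1, m)], where [4 (m + 1) + 1] is exactly [2n + 3]. *)
have even m : 16 ^ m <= (4 * m + 1) * 'C(m.*2, m) ^ 2.
  elim: m => // m IH; rewrite doubleS.
  rewrite -(leq_pmul2l (_ : 0 < m.+1 ^ 2)) ?expn_gt0 //.
  rewrite mulnCA -expnMn step [16 ^ _]expnS.
  apply: (@leq_trans (m.+1 ^ 2 * (16 * ((4 * m + 1) * 'C(m.*2, m) ^ 2)))).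
    by rewrite !leq_mul2l IH !orbT.
  rewrite expnMn; move: ('C(_, _) ^ 2) => C.
  rewrite !mulnA leq_mul2r; apply/orP; right.
  by rewrite -[m.*2]addnn; lia.
have [odd_n|even_n] := boolP (odd n); last first.
  have nE : n = n./2.*2 by rewrite -[LHS]odd_double_half (negbTE even_n).
  move: (n./2) nE => m ->{n even_n}.
  have -> : 4 ^ m.*2 = 16 ^ m by rewrite -mul2n expnM.
  by apply: leq_trans (even m) _; rewrite leq_mul2r; apply/orP; right; lia.
have nE : n = n./2.*2.+1 by rewrite -[LHS]odd_double_half odd_n.
move: (n./2) nE => m ->{n odd_n}.
have := even m.+1; rewrite doubleS binS mid.
have -> : 4 ^ m.*2.+1 = 4 * 16 ^ m by rewrite expnS -mul2n expnM.
rewrite addnn -mul2n expnMn [16 ^ _]expnS; move: ('C(_, _) ^ 2) => C.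
by move: (16 ^ m); lia.
Qed.

(** Passing from layer [h + j] to the next loses at most a fraction [(2j + 1) / (h + 1)] of the
    central coefficient, and the odd numbers sum to [j ^ 2]. *)
Lemma layer_card_lower n j :
  n./2.+1 * 'C(n, n./2) <= n./2.+1 * 'C(n, n./2 + j) + j ^ 2 * 'C(n, n./2).
Proof.
elim: j => [|j IH]; first by rewrite addn0 leq_addr.
set h := n./2 in IH *; set k := h + j in IH *.
have step : k.+1 * 'C(n, k) <= k.+1 * 'C(n, k.+1) + j.*2.+1 * 'C(n, k).
  by rewrite mul_bin_left -mulnDl leq_mul2r; apply/orP; right; lia.
have diff_le : h.+1 * ('C(n, k) - 'C(n, k.+1)) <= j.*2.+1 * 'C(n, h).
  apply: (@leq_trans (k.+1 * ('C(n, k) - 'C(n, k.+1)))).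
    by rewrite leq_mul2r ltnS leq_addr orbT.
  apply: (@leq_trans (j.*2.+1 * 'C(n, k))); first by rewrite mulnBr leq_subLR.
  by rewrite leq_mul2l bin_le_central orbT.
rewrite addnS -/k; move: diff_le; rewrite mulnBr leq_subLR => diff_le.
apply: leq_trans IH _; apply: leq_trans (leq_add diff_le (leqnn _)) _.
by rewrite -addnA leq_add2l -mulnDl leq_mul2r; apply/orP; right; lia.
Qed.

Lemma card_layers n a b :
  #|[set A : {set 'I_n} | a <= #|A| < b]| = \sum_(a <= k < b) 'C(n, k).
Proof.
have [ab|ba] := leqP a b; last first.
  rewrite big_geq ?(ltnW ba) //; apply: eq_card0 => A; rewrite !inE.
  by apply/negP => /andP[]; lia.
elim: b ab => [|b IH] ab.
  by rewrite big_geq //; apply: eq_card0 => A; rewrite !inE ltn0 andbF.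
have [aE|] := eqVneq a b.+1.
  by rewrite aE big_geq //; apply: eq_card0 => A; rewrite !inE; lia.
move=> ne; have {}ab : a <= b by lia.
rewrite big_nat_recr //= -IH // -[X in 'C(X, _)]card_ord -card_draws.
rewrite -cardsUI [X in _ = _ + X]eq_card0 ?addn0.
  by apply: eq_card => A; rewrite !inE ltnS; case: (ltngtP #|A| b) => [||->]; rewrite ?ab ?andbT ?andbF ?orbF ?orbT.
by move=> A; rewrite !inE; case: (ltngtP #|A| b); rewrite ?andbF.
Qed.

Section Variance.
Local Open Scope ring_scope.

Lemma sum_bin_rec {R : pzRingType} n (f : nat -> R) :
  \sum_(k < n.+2) 'C(n.+1, k)%:R * f k =
  \sum_(k < n.+1) 'C(n, k)%:R * (f k + f k.+1).
Proof.
rewrite big_ord_recl bin0.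
under eq_bigr do rewrite binS natrD mulrDl.
under [RHS]eq_bigr do rewrite mulrDr.
rewrite !big_split /= addrA; congr (_ + _).
rewrite big_ord_recr /= bin_small // mul0r addr0.
by rewrite [RHS]big_ord_recl bin0.
Qed.

(** Variance of a walk with steps [1] and [-1]: by Pascal's rule each step uses
    [(y - 1)^2 + (y + 1)^2 = 2 y^2 + 2]. *)
Lemma sum_bin_variance n :
  \sum_(k < n.+1) 'C(n, k)%:R * ((k.*2)%:R - n%:R) ^+ 2 = (n * 2 ^ n)%:R :> int.
Proof.
elim: n => [|n IH]; first by rewrite big_ord1.
rewrite (sum_bin_rec n (fun k => ((k.*2)%:R - n.+1%:R) ^+ 2)).
transitivity (2 * \sum_(k < n.+1) 'C(n, k)%:R * ((k.*2)%:R - n%:R) ^+ 2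
   + 2 * \sum_(k < n.+1) 'C(n, k)%:R :> int).
  rewrite !big_distrr /= -big_split /=; apply: eq_bigr => k _.
  move: (nat_of_ord k) => i; rewrite doubleS !mulrS; ring.
rewrite IH -natr_sum.
have -> : (\sum_(k < n.+1) 'C(n, k) = 2 ^ n)%N.
  by rewrite (Pascal 1 1) //; apply: eq_bigr => k _; rewrite !exp1n !muln1.
by rewrite expnS; move: (2 ^ n)%N => N; lia.
Qed.

Lemma sum_sets_by_card {R : pzRingType} n (f : nat -> R) :
  \sum_(A : {set 'I_n}) f #|A| = \sum_(k < n.+1) 'C(n, k)%:R * f k.
Proof.
have An (A : {set 'I_n}) : (#|A| < n.+1)%N.
  by rewrite ltnS -[leqRHS]card_ord max_card.
rewrite (partition_big (fun A : {set 'I_n} => inord #|A| : 'I_n.+1) predT) //=.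
apply: eq_bigr => k _.
rewrite mulr_natl -[X in 'C(X, _)]card_ord -card_draws -sumr_const.
rewrite (eq_bigl (fun A => A \in [set A : {set 'I_n} | #|A| == k])).
  by apply: eq_bigr => A; rewrite inE => /eqP ->.
by move=> A; rewrite inE -val_eqE /= inordK.
Qed.

(** Chebyshev's inequality: each set of the tail contributes at least [t ^ 2] to the variance
    sum. *)
Lemma card_tail_le n t :
  (t ^ 2 * #|[set A : {set 'I_n} | (#|A|.*2 + t <= n) || (n + t <= #|A|.*2)]|
    <= n * 2 ^ n)%N.
Proof.
set E := [set A | _].
suff : (t ^ 2 * #|E|)%:R <= (n * 2 ^ n)%:R :> int by rewrite ler_nat.
rewrite -sum_bin_variance.
rewrite -(sum_sets_by_card n (fun k => ((k.*2)%:R - n%:R) ^+ 2 : int)).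
rewrite (bigID (mem E)) /= mulnC natrM mulr_natl -sumr_const.
rewrite -[leLHS]addr0 lerD //; last by apply: sumr_ge0 => A _; exact: sqr_ge0.
apply: ler_sum => A; rewrite inE natrX => AE.
move: AE; move: #|A| => a; rewrite -mul2n; nia.
Qed.
End Variance.

(** * Lower bound: families inside [q - p] consecutive layers *)

Lemma card_layers_lower p q n :
  (q - p) * n./2.+1 * 'C(n, n./2) <=
  n./2.+1 * #|[set A : {set 'I_n} | n./2 <= #|A| < n./2 + (q - p)]|
    + (q - p) ^ 3 * 'C(n, n./2).
Proof.
rewrite card_layers; elim: (q - p) => [|m IH]; first by rewrite mul0n.
rewrite addnS big_nat_recr ?leq_addr //=.
have := layer_card_lower n m.
move: n./2.+1 ('C(n, n./2)) ('C(n, n./2 + m)) (\sum_(_ <= _ < _) _) IH => h1 N Nm S IH Lm.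
(* The losses [j ^ 2] of the single layers are summed crudely into a cube. *)
have m3 : m ^ 3 + m ^ 2 <= m.+1 ^ 3 by nia.
have := leq_add IH Lm; have := leq_mul m3 (leqnn N).
by rewrite !mulnDl mulnDr -!mulnA mulSn; lia.
Qed.

(** By coprimality the differences of a related pair have sizes [t * p] and [t * q], with [t > 0] as
    the cardinalities differ. These cardinalities are thus at least [q - p] apart. *)
Lemma layers_independent p q n (F : {set {set 'I_n}}) : coprime p q -> p < q ->
  F \subset [set A : {set 'I_n} | n./2 <= #|A| < n./2 + (q - p)] ->
  independent (tilted_rel p q n) F.
Proof.
move=> copq pq /fintype.subsetP FL; apply/independentP => A B /FL + /FL.
rewrite !inE => Abd Bbd; apply/negP => rAB.
have := tilted_rel_card_lt pq rAB; case/andP: rAB => _ /eqP E.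
have := cardsID B A; have := cardsID A B; rewrite finset.setIC.
have /dvdnP[t bE] : q %| #|B :\: A|.
  by rewrite -(Gauss_dvdr _ (_ : coprime q p)) 1?coprime_sym // -E dvdn_mulr.
have aE : #|A :\: B| = t * p.
  apply/eqP; rewrite -(eqn_pmul2l (_ : 0 < q)) ?E ?bE; [|lia].
  by rewrite mulnCA [q * _]mulnCA [p * q]mulnC.
rewrite aE bE; case: t {aE bE} => [|t]; first by lia.
rewrite !mulSn; have : t * p <= t * q by rewrite leq_mul2l (ltnW pq) orbT.
by lia.
Qed.

Lemma card_tilted_families_ge p q n : coprime p q -> p < q ->
  2 ^ #|[set A : {set 'I_n} | n./2 <= #|A| < n./2 + (q - p)]|
    <= #|tilted_sperner_families p q n|.
Proof.
move=> copq pq; rewrite -card_powerset; apply: subset_leq_card.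
apply/fintype.subsetP => F; rewrite !inE => FL.
by rewrite tilted_sperner_independent; exact: layers_independent.
Qed.

(** * Upper bound with free parameters *)

Section Upper.
Context {R : realType} {p q n w c d : nat} (x : R).
Local Notation h := n./2.
Local Notation tail :=
  #|[set A : {set 'I_n} | (#|A|.*2 + w.*2.+1 <= n) || (n + w.*2.+1 <= #|A|.*2)]|.

(** The window is [L = h - w], [U = h + w + 1], so [U - L = 2w + 1]. A sparse [S] is bounded by
    supersaturation inside the window and by [tail] outside. *)
Lemma card_tilted_families_le : p < q -> d < c -> w <= h -> p * w.*2.+1 <= h - w ->
  h + w.+1 + p * w.*2.+1 + c <= n ->
  (1 <= x)%R -> (x ^+ d + 1 <= x ^+ d.+1)%R ->
  (#|tilted_sperner_families p q n|%:R
     <= 2 ^+ (c * (q - p) * 'C(n, h) %/ (c - d) + tail) * x ^+ (2 ^ n))%R.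
Proof.
move=> pq dc wh pw wc x1 xd.
set M := _ + tail.
have irr : irreflexive (tilted_rel p q n) by move=> A; rewrite /tilted_rel eqxx.
have := @card_independent_le R {set 'I_n} _ d M x irr x1 xd _ [set: {set 'I_n}].
have -> : #|[set: {set 'I_n}]| = 2 ^ n.
  by rewrite -powersetT card_powerset cardsT card_ord.
move=> H.
have -> : #|tilted_sperner_families p q n| =
   #|[set F : {set {set 'I_n}} | (F \subset [set: {set 'I_n}]) && independent (tilted_rel p q n) F]|.
  by apply: eq_card => F; rewrite !inE finset.subsetT.
apply: H => S Sd.
pose mid := [set A : {set 'I_n} | h - w <= #|A| < h + w.+1].
rewrite -(cardsID mid S) leq_add //.
  rewrite leq_divRL ?subn_gt0 // mulnC.
  have UL : h + w.+1 - (h - w) = w.*2.+1 by lia.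
  apply: (@sparse_tilted_card_le p q n (h - w) (h + w.+1)); rewrite ?UL //; [lia|..].
    by move=> A; rewrite !inE => /andP[].
  move=> A; rewrite inE => /andP[AS _]; apply: leq_ltn_trans (Sd A AS).
  by apply: subset_leq_card; apply/fintype.subsetP => B; rewrite !inE => /andP[/andP[-> _] ->].
(* Outside the window the doubled size is at least [2w + 1] away from [n], whatever the parity of
   [n]. *)
apply: subset_leq_card; apply/fintype.subsetP => A; rewrite !inE => /andP[+ _].
move: #|A| => a; lia.
Qed.
End Upper.

(** * Choice of parameters and logarithmic bounds *)

Section Asymptotics.
Local Open Scope ring_scope.
Context {R : realType}.

Lemma bernoulli_le (y : R) e : 0 <= y -> 1 + e%:R * y <= (1 + y) ^+ e.
Proof.
move=> y0; elim: e => [|e IH]; first by rewrite expr0 mul0r addr0.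
rewrite exprS mulrDl mul1r -natr1 mulrDl mul1r addrA lerD // -{1}[y]mulr1.
by rewrite ler_wpM2l // exprn_ege1 // lerDl.
Qed.

Lemma ln2_ge_half : 2^-1 <= ln 2 :> R.
Proof.
have := @le_ln1Dx R (- 2^-1).
have -> : 1 + - 2^-1 = 2^-1 :> R by field.
rewrite lnV ?posrE // => H; rewrite -lerN2; apply: H; lra.
Qed.

Lemma pow2_le_sqrt_central n : (0 < n)%N ->
  2 ^+ n <= 3 * Num.sqrt n%:R * 'C(n, n./2)%:R :> R.
Proof.
move=> n0; have := central_bin_lower n.
(* For [n >= 1], [2n + 3 <= 9n]; the square [9] yields the factor [3]. *)
have H : (4 ^ n <= 9 * n * 'C(n, n./2) ^ 2)%N -> 2 ^+ n <= 3 * Num.sqrt n%:R * 'C(n, n./2)%:R :> R.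
  rewrite -(ler_nat R) !natrM !natrX => H.
  rewrite -(@ler_pXn2r _ 2) ?nnegrE ?exprn_ge0 ?mulr_ge0 ?sqrtr_ge0 ?ler0n //.
  rewrite !exprMn sqr_sqrtr ?ler0n // -exprM mulnC exprM.
  have -> : 2 ^+ 2 = 4 :> R by ring.
  by have -> : 3 ^+ 2 = 9 :> R by ring.
move=> H2; apply: H; apply: leq_trans H2 _; rewrite leq_mul2r; apply/orP; right.
by lia.
Qed.

Lemma ln_families_lower p q n : coprime p q -> (p < q)%N ->
  ((q - p)%:R - (q - p)%:R ^+ 3 / n./2.+1%:R) * 'C(n, n./2)%:R * ln 2
    <= ln #|tilted_sperner_families p q n|%:R :> R.
Proof.
move=> copq pq; have := card_tilted_families_ge p q n copq pq; set l := #|[set A | _]| => H.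
have ln2 : 0 < ln 2 :> R by rewrite ln_gt0 // ltr1n.
apply: (@le_trans _ _ (l%:R * ln 2)).
  rewrite ler_pM2r // -(@ler_pM2r _ n./2.+1%:R) ?ltr0n // -natrX.
  have := card_layers_lower p q n; rewrite -/l.
  move: ((q - p) ^ 3)%N => g3; rewrite -(ler_nat R) natrD !natrM => H2.
  have h0 : n./2.+1%:R != 0 :> R by rewrite pnatr_eq0.
  rewrite mulrAC mulrBl divfK // mulrBl.
  by rewrite lerBlDr [l%:R * _]mulrC.
rewrite mulr_natl -lnXn // -natrX ler_ln ?posrE ?ltr0n ?expn_gt0 // ?ler_nat //.
by apply: leq_trans H; rewrite expn_gt0.
Qed.

(** The claim is [x ^+ d * (x - 1) >= 1]. Bernoulli on [x ^+ d] is too weak, as it gives order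
    [T ^ -3]; applied to half the exponent and squared, it gives [sqrt n / (256 T ^ 5)]. *)
Lemma container_step (T n : nat) (d := (n %/ 4 %/ T)%N)
    (x := 1 + (T%:R * Num.sqrt n%:R)^-1 : R) :
  (2 <= T)%N -> (256 * T ^ 5)%:R <= Num.sqrt n%:R :> R ->
  x ^+ d + 1 <= x ^+ d.+1.
Proof.
move=> T2; rewrite natrM natrX; set s := Num.sqrt _ => sT.
set e := (n %/ (8 * T))%N.
have T0 : 0 < T%:R :> R by rewrite ltr0n; lia.
have s1 : 1 <= s.
  apply: le_trans sT; rewrite -natrX -natrM ler1n muln_gt0 expn_gt0 /=; lia.
have s0 : 0 < s by apply: lt_le_trans s1.
have ns : n%:R = s ^+ 2 :> R by rewrite sqr_sqrtr ?ler0n.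
pose y := (T%:R * s)^-1; have y0 : 0 < y by rewrite invr_gt0 mulr_gt0.
have ed : (e * 2 <= d)%N.
  rewrite /d -divnMA leq_divRL ?muln_gt0 /= ?(ltnW T2) //.
  by apply: leq_trans (leq_trunc_div n (8 * T)); rewrite -/e; lia.
have Tn : (8 * T <= n)%N.
  rewrite -(ler_nat R) ns natrM; apply: (@le_trans _ _ s); last first.
    by rewrite expr2 ler_peMr // ltW.
  apply: le_trans sT; rewrite -natrX -!natrM ler_nat leq_mul //.
  by rewrite -{1}[T]expn1 leq_exp2l.
(* Rounding down in [e] costs at most a factor [2], since [e >= 1]. *)
have en : (n <= 16 * T * e)%N.
  have := ltn_ceil n (_ : 0 < 8 * T)%N; rewrite -/e => /(_ ltac:(lia)) H.
  have e1 : (0 < e)%N by rewrite divn_gt0 //; lia.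
  by nia.
have ey : s / (16 * T%:R ^+ 2) <= e%:R * y.
  rewrite /y ler_pdivrMr ?mulr_gt0 ?exprn_gt0 //.
  have -> : e%:R * (T%:R * s)^-1 * (16 * T%:R ^+ 2) = (16 * T%:R * e%:R) / s.
    by field; rewrite !gt_eqF.
  rewrite ler_pdivlMr // -expr2 -ns -natrM -natrM ler_nat.
  exact: en.
have xd : (e%:R * y) ^+ 2 <= x ^+ d.
  apply: (@le_trans _ _ (x ^+ (e * 2))); last first.
    by rewrite ler_weXn2l // lerDl ltW.
  rewrite exprM lerXn2r ?nnegrE ?mulr_ge0 ?exprn_ge0 ?addr_ge0 ?(ltW y0) //.
  by apply: le_trans (bernoulli_le _ e (ltW y0)); rewrite lerDr.
rewrite exprS mulrDl mul1r lerD2l.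
apply: (@le_trans _ _ (y * (s / (16 * T%:R ^+ 2)) ^+ 2)).
  have -> : y * (s / (16 * T%:R ^+ 2)) ^+ 2 = s / (256 * T%:R ^+ 5).
    by rewrite /y; field; rewrite !gt_eqF.
  have T5 : 0 < 256 * T%:R ^+ 5 :> R by rewrite mulr_gt0 ?ltr0n // exprn_gt0.
  by rewrite (ler_pdivlMr _ _ T5) mul1r.
rewrite ler_pM2l //; apply: le_trans xd.
by rewrite lerXn2r ?nnegrE ?divr_ge0 ?mulr_ge0 ?exprn_ge0 ?(ltW s0) ?(ltW y0) ?(ltW T0).
Qed.

(** Chebyshev with deviation [2w + 1 > n / P] bounds the tail by [P ^ 2 * 2 ^ n / n], and [2 ^ n] is
    at most [3 sqrt n] times the central coefficient. *)
Lemma central_bin_dominates_tail (P T n w tail : nat) (s := Num.sqrt n%:R : R) :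
  (n < P * (w.*2.+1))%N -> (0 < n)%N ->
  (w.*2.+1 ^ 2 * tail <= n * 2 ^ n)%N -> (3 * P ^ 2 * T)%:R <= s ->
  T%:R * tail%:R <= 'C(n, n./2)%:R :> R.
Proof.
move=> nP n0 tl sT.
have s0 : 0 < s by rewrite sqrtr_gt0 ltr0n.
have ns : n%:R = s ^+ 2 :> R by rewrite sqr_sqrtr ?ler0n.
have H1 : (n * tail <= P ^ 2 * 2 ^ n)%N.
  rewrite -(leq_pmul2l n0) mulnA mulnn.
  apply: (@leq_trans ((P * w.*2.+1) ^ 2 * tail)).
    by rewrite leq_mul2r leq_exp2r // ltnW // orbT.
  by rewrite expnMn -mulnA [leqRHS]mulnCA leq_mul2l tl orbT.
have H2 : s * tail%:R <= P%:R ^+ 2 * 3 * 'C(n, n./2)%:R.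
  rewrite -(ler_pM2l s0) mulrA -expr2 -ns -natrM.
  apply: (@le_trans _ _ (P%:R ^+ 2 * 2 ^+ n)).
    by rewrite -!natrX -natrM ler_nat.
  have := pow2_le_sqrt_central n n0; rewrite -/s => H.
  have -> : s * (P%:R ^+ 2 * 3 * 'C(n, n./2)%:R) = P%:R ^+ 2 * (3 * s * 'C(n, n./2)%:R) by ring.
  by rewrite ler_wpM2l ?exprn_ge0.
have [t0|tpos] := posnP tail; first by rewrite t0 mulr0.
have [P0|P0] := posnP P; first by rewrite P0 mul0n in nP.
have P2 : 0 < P%:R ^+ 2 * 3 :> R by rewrite mulr_gt0 ?exprn_gt0 ?ltr0n.
rewrite -(ler_pM2l P2); apply: le_trans H2.
rewrite mulrA ler_wpM2r //; apply: le_trans sT.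
by rewrite natrM natrM natrX [3%:R * _]mulrC.
Qed.

(** From [d <= c / T], [c / (c - d) <= T / (T - 1) <= 1 + 2 / T], the last step because [T >= 2]. *)
Lemma sparse_bound_quotient_le (c d g N T : nat) : (2 <= T)%N -> (d < c)%N ->
  (d * T <= c)%N -> (c * g * N %/ (c - d) * T <= g * N * (T + 2))%N.
Proof.
move=> T2 dc dT; set K := (_ %/ _)%N.
have H1 : (K * (c - d) <= c * g * N)%N by exact: leq_trunc_div.
have H2 : ((T - 1) * c <= T * (c - d))%N by rewrite mulnBl mulnBr mul1n mulnC; lia.
have c0 : (0 < c)%N by lia.
have H3 : (K * (T - 1) <= T * (g * N))%N.
  rewrite -(leq_pmul2r c0) -mulnA.
  apply: leq_trans (leq_mul (leqnn K) H2) _; rewrite mulnCA -mulnA leq_mul2l.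
  by apply/orP; right; apply: leq_trans H1 _; rewrite -mulnA mulnC.
have T1 : (0 < T - 1)%N by lia.
rewrite -(leq_pmul2r T1) mulnAC.
apply: (@leq_trans (T * (g * N) * T)); first by rewrite leq_mul2r H3 orbT.
rewrite [(T * (g * N))%N]mulnC -!mulnA !leq_mul2l.
by apply/orP; right; apply/orP; right; nia.
Qed.

Lemma window_bounds (n p w c : nat) :
  (w * (16 * p.+1) <= n)%N -> (768 * p.+1 <= n)%N -> (c * 4 <= n)%N ->
  [/\ (w <= n./2)%N, (p * w.*2.+1 <= n./2 - w)%N
    & (n./2 + w.+1 + p * w.*2.+1 + c <= n)%N].
Proof.
have -> : (w * (16 * p.+1) = 16 * (p * w) + 16 * w)%N by lia.
have -> : (p * w.*2.+1 = 2 * (p * w) + p)%N by lia.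
by move: (p * w)%N => pw H1 H2 H3; split; lia.
Qed.

(* The window of sizes has radius n / (16 (p + 1)), whence 768 = 3 * 16 ^ 2 in
   the tail estimate; 256 T ^ 5 is the threshold of container_step. *)
Lemma ln_families_upper p q (T m n : nat) : coprime p q -> (p < q)%N -> (2 <= T)%N ->
  (768 * p.+1 ^ 2 * T + 256 * T ^ 5 <= m)%N -> (m ^ 2 <= n)%N ->
  ln #|tilted_sperner_families p q n|%:R
    <= ((q - p)%:R + (2 * (q - p)%:R + 7) / T%:R) * 'C(n, n./2)%:R * ln 2 :> R.
Proof.
move=> copq pq T2 mT nm.
pose s := Num.sqrt n%:R : R.
(* The natural number [m] stands below [sqrt n], so the thresholds are checked in [nat]. *)
have sm : m%:R <= s.
  by rewrite -[leLHS]ger0_norm // -sqrtr_sqr ler_sqrt // -natrX ler_nat.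
have mp : (768 * p.+1 ^ 2 * T <= m)%N by apply: leq_trans mT; exact: leq_addr.
have mT5 : (256 * T ^ 5 <= m)%N by apply: leq_trans mT; exact: leq_addl.
clear mT.
have pT : (768 * p.+1 <= n)%N.
  have PT : (1 <= p.+1 * T)%N by rewrite muln_gt0 /=; lia.
  have mn : (m <= n)%N by apply: leq_trans nm; case: (m) => // k; rewrite -mulnn leq_pmulr.
  apply: leq_trans mn; apply: leq_trans mp.
  by rewrite -mulnn [(768 * (_ * _))%N]mulnA -[leqRHS]mulnA leq_pmulr.
have n0 : (0 < n)%N by lia.
have s0 : 0 < s by rewrite sqrtr_gt0 ltr0n.
pose w := (n %/ (16 * p.+1))%N; pose c := (n %/ 4)%N; pose d := (c %/ T)%N.
have w16 : (w * (16 * p.+1) <= n)%N by exact: leq_trunc_div.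
have c4 : (c * 4 <= n)%N by exact: leq_trunc_div.
have dc : (d < c)%N by rewrite ltn_Pdiv // divn_gt0 //; lia.
pose t := #|[set A : {set 'I_n} | (#|A|.*2 + w.*2.+1 <= n)%N || (n + w.*2.+1 <= #|A|.*2)%N]|.
pose x : R := 1 + (T%:R * s)^-1.
have T0 : 0 < T%:R :> R by rewrite ltr0n; lia.
have y0 : 0 < (T%:R * s)^-1 by rewrite invr_gt0 mulr_gt0.
have [wh pw wc] := window_bounds n p w c w16 pT c4.
have := @card_tilted_families_le R p q n w c d x pq dc wh pw wc; rewrite -/t => fam.
have {}fam : #|tilted_sperner_families p q n|%:R
     <= 2 ^+ (c * (q - p) * 'C(n, n./2) %/ (c - d) + t) * x ^+ (2 ^ n) :> R.
  apply: fam; first by rewrite lerDl ltW.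
  apply: container_step T2 _; apply: le_trans sm.
  by rewrite ler_nat.
have ln20 : 0 < ln 2 :> R by rewrite ln_gt0 // ltr1n.
have x0 : 0 < x by rewrite addr_gt0.
have fam0 : (0 < #|tilted_sperner_families p q n|)%N.
  by apply: leq_trans (card_tilted_families_ge p q n copq pq); rewrite expn_gt0.
have {}fam : ln #|tilted_sperner_families p q n|%:R <=
    (c * (q - p) * 'C(n, n./2) %/ (c - d) + t)%:R * ln 2 + 2 ^+ n * ln x :> R.
  apply: (@le_trans _ _ (ln (2 ^+ (c * (q - p) * 'C(n, n./2) %/ (c - d) + t) * x ^+ (2 ^ n)))).
    by rewrite ler_ln ?posrE ?mulr_gt0 ?exprn_gt0 ?ltr0n.
  rewrite lnM ?posrE ?exprn_gt0 // !lnXn // -[ln x *+ _]mulr_natl natrX.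
  by rewrite -[ln 2 *+ _]mulr_natl.
(* Here [ln x <= x - 1] gives [3 N / T] for the central coefficient [N]; the bound [ln 2 >= 1 / 2]
   turns this into [6 N / T] times [ln 2]. *)
have lnx : 2 ^+ n * ln x <= 6 * 'C(n, n./2)%:R / T%:R * ln 2.
  apply: (@le_trans _ _ (3 * s * 'C(n, n./2)%:R * (T%:R * s)^-1)).
    apply: ler_pM; rewrite ?exprn_ge0 ?ln_ge0 ?lerDl ?(ltW y0) //.
      exact: pow2_le_sqrt_central.
    by apply: le_ln1Dx; apply: lt_trans y0; rewrite ltrN10.
  have -> : 3 * s * 'C(n, n./2)%:R * (T%:R * s)^-1 = 6 * 'C(n, n./2)%:R / T%:R * 2^-1.
    by field; rewrite !gt_eqF.
  rewrite ler_wpM2l ?ln2_ge_half // divr_ge0 ?mulr_ge0 // ltW.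
have tl : T%:R * t%:R <= 'C(n, n./2)%:R :> R.
  apply: (@central_bin_dominates_tail (16 * p.+1) T n w).
  - have := ltn_ceil n (_ : 0 < 16 * p.+1)%N; rewrite -/w => /(_ isT) H.
    apply: leq_trans H _.
    by rewrite mulnC leq_mul2l ltnS -addnn leq_addr orbT.
  - exact: n0.
  - exact: card_tail_le.
  - apply: le_trans sm; rewrite ler_nat; apply: leq_trans mp.
    by rewrite expnMn mulnA.
have mt := @sparse_bound_quotient_le c d (q - p) 'C(n, n./2) T T2 dc (leq_trunc_div _ _).
move: mt; rewrite -(ler_nat R) natrM [X in _ <= X]natrM natrM natrD => mt.
apply: le_trans fam _; apply: le_trans (lerD (lexx _) lnx) _.
(* After multiplication by [T], the error [2 g + 7] splits into [2 g] from the quotient, [1] from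
   the tail and [6] from the container factor. *)
rewrite -mulrDl ler_pM2r // -(ler_pM2r T0) natrD.
move: mt tl; set K := (_ %/ _)%N; set g := (q - p)%:R; set N := 'C(_, _)%:R => mt tl.
have -> : (K%:R + t%:R + 6 * N / T%:R) * T%:R = K%:R * T%:R + T%:R * t%:R + 6 * N.
  by field; rewrite gt_eqF.
have -> : (g + (2 * g + 7) / T%:R) * N * T%:R = g * N * (T%:R + 2) + N + 6 * N.
  by field; rewrite gt_eqF.
by rewrite lerD2r lerD.
Qed.
End Asymptotics.

(** * The limit *)

Local Open Scope classical_set_scope.
Local Open Scope ring_scope.

Theorem theorem4p1 (R : realType) (p q : nat)
  (coprime_pq : coprime p q) (lt_pq : (p < q)%N) :
  exists eps : nat -> R,
    (eps n @[n --> \oo] --> (0 : R)) /\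
    forall n : nat,
      (#|tilted_sperner_families p q n|%:R : R) =
      2 `^ ((q%:R - p%:R + eps n) * 'C(n, n./2)%:R).
Proof.
have ln20 : 0 < ln 2 :> R by rewrite ln_gt0 // ltr1n.
have N0 n : 0 < 'C(n, n./2)%:R :> R by rewrite ltr0n bin_gt0; lia.
have f0 n : 0 < #|tilted_sperner_families p q n|%:R :> R.
  by rewrite ltr0n (leq_trans _ (card_tilted_families_ge p q n _ _)) // expn_gt0.
have gE : (q - p)%:R = q%:R - p%:R :> R by rewrite natrB // ltnW.
(* The exponent equation is solved for [eps], so only its convergence needs the two bounds. *)
exists (fun n => ln #|tilted_sperner_families p q n|%:R / ('C(n, n./2)%:R * ln 2)
  - (q%:R - p%:R)); split; last first.
  move=> n; rewrite addrC subrK /powR pnatr_eq0 /=.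
  have -> : ln #|tilted_sperner_families p q n|%:R / ('C(n, n./2)%:R * ln 2)
    * 'C(n, n./2)%:R * ln 2 = ln #|tilted_sperner_families p q n|%:R :> R.
    by field; rewrite !gt_eqF.
  by rewrite lnK // posrE.
apply/cvgrPdist_le => e e0; rewrite -gE; set g := (q - p)%:R.
have [T1 T1e] : exists T : nat, (2 * g + 7) / e <= T%:R.
  by exists (Num.truncn ((2 * g + 7) / e)).+1; rewrite ltW // truncnS_gt.
have [m me] : exists m : nat, g ^+ 3 / e <= m%:R.
  by exists (Num.truncn (g ^+ 3 / e)).+1; rewrite ltW // truncnS_gt.
pose T := maxn 2 T1.
pose m' := (768 * p.+1 ^ 2 * T + 256 * T ^ 5)%N.
(* [n >= 2m] makes the lower error [g ^ 3 / (n./2 + 1)] at most [e]; [n >= m' ^ 2] admits the upper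
   bound, whose error is at most [e] by the choice of [T]. *)
exists (maxn m.*2 (m' ^ 2)) => // n /=.
rewrite geq_max => /andP[nm nT].
have T2 : (2 <= T)%N by rewrite leq_maxl.
have T0 : 0 < T%:R :> R by rewrite ltr0n; lia.
have h0 : 0 < n./2.+1%:R :> R by rewrite ltr0n.
have NL : 0 < 'C(n, n./2)%:R * ln 2 :> R by rewrite mulr_gt0.
rewrite sub0r normrN ler_distl.
have up := @ln_families_upper R p q T m' n coprime_pq lt_pq T2 (leqnn _) nT.
have lo := @ln_families_lower R p q n coprime_pq lt_pq.
rewrite -/g -mulrA in up; rewrite -/g -mulrA in lo.
apply/andP; split.
  rewrite ler_pdivlMr //; apply: le_trans lo; rewrite ler_pM2r // lerD2l lerN2.
  rewrite ler_pdivrMr // mulrC -ler_pdivrMr //; apply: le_trans me _.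
  by rewrite ler_nat (leq_trans _ (leqnSn _)) // -[m]doubleK half_leq.
rewrite ler_pdivrMr //; apply: le_trans up _; rewrite ler_pM2r // lerD2l.
rewrite ler_pdivrMr // [e * _]mulrC -ler_pdivrMr //; apply: le_trans T1e _.
by rewrite ler_nat leq_maxr.
Qed.
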